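(* For any integers $k$, $l$, $m$ with $0\leq l\leq k\leq m$, \[ S_3(m+k+l)+S_3(m-k)+S_3(m-l)-3S_3(m)\leq 2k+l. \]
   Context: $s_3(n)$ denotes the sum of the ternary (base $3$) digits of the nonnegative integer $n$, and $S_3(N)=\sum_{n=0}^{N-1}s_3(n)$ for $N\in\mathbb{Z}_{\ge0}$ (so $S_3(0)=0$). *)

(* Defs.v *)
From mathcomp Require Import all_boot all_order all_algebra.

Set Implicit Arguments.
Unset Strict Implicit.
Unset Printing Implicit Defensive.

Definition ternary_digit (n i : nat) : nat := (n %/ 3 ^ i) %% 3.

(* Only the digits at positions i < n are summed; by [ternary_digit_eq0]
   those at positions i >= n are all zero. *)
Definition s3 (n : nat) : nat := \sum_(i < n) ternary_digit n i.

Definition S3 (N : nat) : nat := \sum_(n < N) s3 n.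

Lemma ternary_digit_eq0 (n i : nat) : n <= i -> ternary_digit n i = 0.
Proof.
move=> le_ni; rewrite /ternary_digit divn_small ?mod0n //.
exact: leq_ltn_trans le_ni (ltn_expl i (isT : 1 < 3)).
Qed.

(* Main.v *)
Require Import Defs.
From mathcomp Require Import all_boot all_order all_algebra.
From mathcomp Require Import zify.

(** With [a = m - k], [b = m - l], [c = m + k + l] one has [a <= b <= c] and
    [a + b + c = 3 m], so by [S3 (3 m) = 3 S3 m + 3 m] the theorem is the case
    [3 %| a + b + c] of the superadditivity
    [S3 a + S3 b + S3 c + 2 a + b <= S3 (a + b + c)].
    This superadditivity goes by strong induction: the recursion expresses
    [S3 N] through the three values [S3 ((N + j) %/ 3)], [j < 3], and the nine
    values coming from [a], [b], [c] are regrouped into three triples whose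
    sums are the numbers [(a + b + c + j) %/ 3]. *)

Lemma s3_widen (n M : nat) : n <= M -> s3 n = \sum_(i < M) ternary_digit n i.
Proof.
move=> le_nM; rewrite /s3 (big_ord_widen M (ternary_digit n) le_nM) big_mkcond.
by apply: eq_bigr => i _; case: ltnP => // /ternary_digit_eq0.
Qed.

Lemma ternary_digit_mul3D0 (n r : nat) : r < 3 -> ternary_digit (3 * n + r) 0 = r.
Proof. by move=> r3; rewrite /ternary_digit expn0; lia. Qed.

Lemma ternary_digit_mul3DS (n r i : nat) :
  r < 3 -> ternary_digit (3 * n + r) i.+1 = ternary_digit n i.
Proof.
move=> r3; rewrite /ternary_digit expnS divnMA.
by congr ((_ %/ _) %% _); lia.
Qed.

Lemma s3_mul3D (n r : nat) : r < 3 -> s3 (3 * n + r) = s3 n + r.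
Proof.
move=> r3; rewrite (@s3_widen _ (3 * n + r).+1) // big_ord_recl.
rewrite (@s3_widen n (3 * n + r)); last by lia.
rewrite ternary_digit_mul3D0 // addnC; congr (_ + _).
by apply: eq_bigr => i _; exact: ternary_digit_mul3DS.
Qed.

Lemma S3S (n : nat) : S3 n.+1 = S3 n + s3 n.
Proof. by rewrite /S3 big_ord_recr. Qed.

Lemma S3_mul3 (n : nat) : S3 (3 * n) = 3 * S3 n + 3 * n.
Proof.
elim: n => [|n IHn]; first by rewrite /S3 !big_ord0.
have -> : 3 * n.+1 = (3 * n + 2).+1 by lia.
rewrite S3S s3_mul3D // addnS S3S s3_mul3D // addnS S3S addn0.
have -> : s3 (3 * n) = s3 n by rewrite -[3 * n]addn0 s3_mul3D ?addn0.
by rewrite IHn S3S; lia.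
Qed.

(** Sort the numbers below [3 * q + r] by last digit [d]: there are [q + (d < r)] of them, whose
    last digits add up to [d * (q + (d < r))]. *)
Lemma S3_mul3D (q r : nat) : r < 3 ->
  S3 (3 * q + r) = S3 (q + (0 < r)) + S3 (q + (1 < r)) + S3 q + 3 * q + (1 < r).
Proof.
case: r => [|[|[|//]]] _; rewrite /= ?addn0 ?addn1.
- by rewrite S3_mul3; lia.
- by rewrite S3S -[in s3 _](addn0 (3 * q)) s3_mul3D // S3_mul3 S3S; lia.
- rewrite addn2 S3S -addn1 s3_mul3D // addn1 S3S.
  by rewrite -[in s3 (3 * q)](addn0 (3 * q)) s3_mul3D // S3_mul3 S3S; lia.
Qed.

(** The shift [s] only permutes the three values; it is free to choose for aligning the columns of
    several numbers. *)
Lemma S3_mul3D_cyclic (s q r : nat) : r < 3 ->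
  S3 (3 * q + r) = S3 (q + (s %% 3 < r)) + S3 (q + ((s + 1) %% 3 < r))
    + S3 (q + ((s + 2) %% 3 < r)) + 3 * q + (1 < r).
Proof.
move=> r3; rewrite S3_mul3D //.
have cyc j : (s + j) %% 3 = (s %% 3 + j) %% 3 by rewrite modnDml.
rewrite 2!cyc; have: s %% 3 < 3 by rewrite ltn_mod.
case: (s %% 3) => [|[|[|//]]] _;
  case: r r3 => [|[|[|//]]] _; rewrite /= ?addn0 ?addn1; lia.
Qed.

(** The symmetric form with [minn] and [maxn] lets the induction hypothesis apply to triples in any
    order; for [a <= b <= c] the extra terms amount to [2 * a + b]. *)
Lemma S3_superadditive (a b c : nat) :
  S3 a + S3 b + S3 c + (a + b + c) + minn a (minn b c)
    <= S3 (a + b + c) + maxn a (maxn b c).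
Proof.
have [n] := ubnP (a + b + c); elim: n a b c => // n IHn a b c lt_n.
(* The largest column sum [(a + b + c + 2) %/ 3] is below [a + b + c] only from 2 on. *)
have [le1|gt1] := leqP (a + b + c) 1.
  have S3_le1 x : x <= 1 -> S3 x = 0.
    by case: x => [|[|//]] _; rewrite /S3 ?big_ord1 /s3 !big_ord0.
  by rewrite !S3_le1; lia.
have div3 x : exists q, exists2 r, r < 3 & x = 3 * q + r.
  by exists (x %/ 3), (x %% 3); lia.
have [a' [r r_lt3 Da]] := div3 a; have [b' [s s_lt3 Db]] := div3 b.
have [c' [t t_lt3 Dc]] := div3 c.
(* The [r], then [s], then [t] unit increments are dealt cyclically to the
   columns 0, 1, 2, so that the column sums differ by at most one. *)
pose u j := a' + (j %% 3 < r).
pose v j := b' + ((2 * r + j) %% 3 < s).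
pose w j := c' + ((2 * (r + s) + j) %% 3 < t).
pose q := a' + b' + c' + (r + s + t) %/ 3.
pose p := (r + s + t) %% 3.
have Euvw j : j < 3 -> u j + v j + w j = q + (j %% 3 < p).
  rewrite {}/u {}/v {}/w {}/q {}/p => j3 {Da Db Dc}.
  by case: j j3 => [|[|[|//]]] _; case: r r_lt3 => [|[|[|//]]] _;
    case: s s_lt3 => [|[|[|//]]] _; case: t t_lt3 => [|[|[|//]]] _; lia.
have IH j : j < 3 -> S3 (u j) + S3 (v j) + S3 (w j) + (u j + v j + w j)
    + minn (u j) (minn (v j) (w j))
    <= S3 (q + (j %% 3 < p)) + maxn (u j) (maxn (v j) (w j)).
  move=> j3; rewrite -Euvw //; apply: IHn; rewrite Euvw // /q /p; lia.
have DN : a + b + c = 3 * q + p by rewrite /q /p; lia.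
have Ea : S3 a = S3 (u 0) + S3 (u 1) + S3 (u 2) + 3 * a' + (1 < r).
  by rewrite Da (S3_mul3D_cyclic 0).
have Eb : S3 b = S3 (v 0) + S3 (v 1) + S3 (v 2) + 3 * b' + (1 < s).
  by rewrite Db (S3_mul3D_cyclic (2 * r)) // /v addn0.
have Ec : S3 c = S3 (w 0) + S3 (w 1) + S3 (w 2) + 3 * c' + (1 < t).
  by rewrite Dc (S3_mul3D_cyclic (2 * (r + s))) // /w addn0.
have EN : S3 (a + b + c) = S3 (q + (0 %% 3 < p)) + S3 (q + (1 %% 3 < p))
    + S3 (q + (2 %% 3 < p)) + 3 * q + (1 < p).
  by rewrite DN (S3_mul3D_cyclic 0) // ltn_mod.
move: (IH 0 isT) (IH 1 isT) (IH 2 isT).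
rewrite Ea Eb Ec EN; do ![move: (S3 _) => ?].
subst a b c; clear IHn IH Euvw Ea Eb Ec EN div3 DN.
rewrite /u /v /w /q /p; clear u v w q p lt_n gt1.
(* A triple [u j, v j, w j] may be out of order when [a'], [b'], [c'] are not
   distinct; the loss is covered by the terms [1 < _] of the recursion. *)
case: r r_lt3 => [|[|[|//]]] _; case: s s_lt3 => [|[|[|//]]] _.
all: case: t t_lt3 => [|[|[|//]]] _; rewrite /= ?addn0 ?addn1; lia.
Qed.

Theorem theorem2 (k l m : nat) (hlk : l <= k) (hkm : k <= m) :
  ((S3 (m + k + l)%N)%:Z + (S3 (m - k)%N)%:Z + (S3 (m - l)%N)%:Z
     - 3%:Z * (S3 m)%:Z <= 2%:Z * k%:Z + l%:Z)%R.
Proof.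
(* The maximum [m + k + l] minus the minimum [m - k] is the bound [2 * k + l]. *)
have := S3_superadditive (m - k) (m - l) (m + k + l).
have -> : m - k + (m - l) + (m + k + l) = 3 * m by lia.
by rewrite S3_mul3; lia.
Qed.
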